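(* Let $r,s,\alpha,\Delta,K$ be positive integers with $r>s$. Then there exists a constant $c>0$ (depending only on $r,s,\alpha,\Delta,K$) such that the following holds. Let $\mathcal F$ be a $\Delta$-bounded family of graphs such that each graph in $\mathcal F$ has at most $K$ isolated vertices. Then for every $n\in\mathbb N$, $$c_{r,s,\alpha}(n,\mathcal F)\ \ge\ c\,n^{1/\chi},$$ where $\chi=\chi(\mathcal{KG}^{(\alpha+1)}(r,r-s))$ is the chromatic number of the Kneser hypergraph $\mathcal{KG}^{(\alpha+1)}(r,r-s)$.
   Context: All graphs are finite and simple; $[r]=\{1,\dots,r\}$. An $r$-colouring of the edges of a graph $G$ is an arbitrary map $E(G)\to[r]$. A family $\mathcal F$ of graphs is $\Delta$-bounded if every graph in $\mathcal F$ has maximum degree at most $\Delta$. A subgraph (not necessarily induced) of an edge-coloured graph is monochromatic if all its edges have the same colour. Subgraphs without edges are monochromatic and use no colour. A monochromatic $\mathcal F$-covering of an edge-coloured graph $G$ is a collection $\mathbf S$ of monochromatic subgraphs of $G$, each isomorphic to a graph in $\mathcal F$, such that every vertex of $G$ belongs to at least one subgraph in $\mathbf S$ (the subgraphs need not be disjoint). $|\mathbf S|$ is the number of subgraphs in the collection, and $\mathrm{col}(\mathbf S)$ is the total number of different colours appearing on edges of subgraphs in $\mathbf S$. For a graph $G$, $c_{r,s}(G,\mathcal F)$ is the smallest number $k$ such that every $r$-colouring of the edges of $G$ admits a monochromatic $\mathcal F$-covering $\mathbf S$ with $|\mathbf S|\le k$ and $\mathrm{col}(\mathbf S)\le s$ (with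 value $+\infty$ if no such $k$ exists). Further, $$c_{r,s,\alpha}(n,\mathcal F)=\max\{c_{r,s}(G,\mathcal F): |V(G)|=n,\ \alpha(G)\le\alpha\},$$ where $\alpha(G)$ is the independence number of $G$. The Kneser hypergraph $\mathcal{KG}^{(\alpha+1)}(r,r-s)$ is the $(\alpha+1)$-uniform hypergraph with vertex set $\{X\subseteq[r]:|X|=r-s\}$ in which vertices $X_1,\dots,X_{\alpha+1}$ form a hyperedge if and only if they are pairwise disjoint as subsets of $[r]$. The chromatic number of a hypergraph is the least number of colours in a vertex colouring with no hyperedge having all its vertices of the same colour (so it equals $1$ if there are no hyperedges). *)

(* Defs.v *)
From HB Require Import structures.
From mathcomp Require Import all_boot all_order all_algebra.
From mathcomp Require Import all_classical all_reals all_analysis.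

Set Implicit Arguments.
Unset Strict Implicit.
Unset Printing Implicit Defensive.

Import Order.TTheory GRing.Theory Num.Theory.

Record sgraph := SGraph {
  vertex :> finType;
  edges : {set {set vertex}};
  card_edge : forall e, e \in edges -> #|e| = 2
}.

Definition degree (G : sgraph) (x : G) : nat := #|[set e in edges G | x \in e]|.

Definition max_degree (G : sgraph) : nat := \max_(x : G) degree x.

Definition isolated (G : sgraph) : {set G} := [set x : G | degree x == 0].

Definition independent (G : sgraph) (A : {set G}) : bool :=
  [forall e in edges G, ~~ (e \subset A)].

Definition independence_number (G : sgraph) : nat :=
  \max_(A : {set G} | independent A) #|A|.

Definition graph_family := sgraph -> Prop.

Definition bounded_family (Delta : nat) (F : graph_family) : Prop :=
  forall H, F H -> max_degree H <= Delta.

Definition few_isolated_family (K : nat) (F : graph_family) : Prop :=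
  forall H, F H -> #|isolated H| <= K.

(* A candidate subgraph is a pair (vertex set, edge set). *)
Definition presubgraph (G : sgraph) : finType := ({set G} * {set {set G}})%type.

Definition is_subgraph (G : sgraph) (S : presubgraph G) : Prop :=
  S.2 \subset edges G /\ (forall e, e \in S.2 -> e \subset S.1).

(* [f] is an isomorphism from [H] onto the subgraph [S] of [G]. *)
Definition subgraph_iso (G H : sgraph) (S : presubgraph G) : Prop :=
  exists f : H -> G,
    [/\ injective f, f @: [set: H] = S.1 &
        [set f @: (e : {set H}) | e in edges H] = S.2].

(* An r-colouring of E(G) is given by a map on all sets of vertices, of which
   only the restriction to [edges G] is ever used; since r > 0, every map
   E(G) -> [r] arises as such a restriction. *)
Definition edge_colouring (r : nat) (G : sgraph) := {set G} -> 'I_r.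

Definition monochromatic (r : nat) (G : sgraph) (phi : edge_colouring r G)
    (S : presubgraph G) : Prop :=
  {in S.2 &, forall e e', phi e = phi e'}.

Definition mono_covering (r : nat) (G : sgraph) (phi : edge_colouring r G)
    (F : graph_family) (C : {set presubgraph G}) : Prop :=
  (forall S, S \in C ->
     [/\ is_subgraph S, monochromatic phi S &
         exists H, F H /\ subgraph_iso H S]) /\
  (forall x : G, exists2 S, S \in C & x \in S.1).

Definition colours_used (r : nat) (G : sgraph) (phi : edge_colouring r G)
    (C : {set presubgraph G}) : nat :=
  #|phi @: (\bigcup_(S in C) S.2)|.

Definition coverable (r s : nat) (G : sgraph) (F : graph_family) (k : nat) :
    Prop :=
  forall phi : edge_colouring r G,
    exists C, [/\ mono_covering phi F C, #|C| <= k & colours_used phi C <= s].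

(* Infimum of a set of natural numbers, hence a minimum, or +oo if empty. *)
Definition cov_num (R : realType) (r s : nat) (G : sgraph) (F : graph_family) :
    \bar R :=
  ereal_inf [set (k%:R%R : R)%:E | k in [set k | coverable r s G F k]]%classic.

(* There are only finitely many graphs of order n up to isomorphism, and at
   least one as soon as alpha > 0, so the supremum is then a maximum. *)
Definition max_cov_num (R : realType) (r s alpha n : nat) (F : graph_family) :
    \bar R :=
  ereal_sup [set x | exists G : sgraph,
    [/\ #|G| = n, independence_number G <= alpha & x = cov_num R r s G F]]%classic.

Record hypergraph := HyperGraph {
  hvertex :> finType;
  hyperedges : {set {set hvertex}}
}.

Definition colourable (H : hypergraph) (k : nat) : bool :=
  [exists f : {ffun H -> 'I_k},
    [forall h in hyperedges H, ~~ [exists i, [forall v in h, f v == i]]]].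

(* The search is bounded by the number of vertices, which suffices as long as
   every hyperedge has at least two vertices; see [chromatic_numberP]. *)
Definition chromatic_number (H : hypergraph) : nat :=
  [arg min_(k < (ord_max : 'I_#|H|.+1) | colourable H k) (k : nat)].

Lemma colourable_card (H : hypergraph) :
  (forall h, h \in hyperedges H -> 1 < #|h|) -> colourable H #|H|.
Proof.
move=> H2; apply/existsP; exists [ffun v => enum_rank v].
apply/forall_inP => h /H2 /card_gt1P[x [y [xh yh xy]]].
apply/negP => /existsP[i /forall_inP hi].
have := hi _ xh; have := hi _ yh; rewrite !ffunE => /eqP <- /eqP /enum_rank_inj.
by move/eqP; rewrite (negPf xy).
Qed.

Lemma chromatic_numberP (H : hypergraph) :
  (forall h, h \in hyperedges H -> 1 < #|h|) ->
  colourable H (chromatic_number H) /\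
  (forall k, colourable H k -> chromatic_number H <= k).
Proof.
move=> /colourable_card H2; rewrite /chromatic_number.
case: arg_minnP => //= i Hi Hmin; split=> // k Hk.
case: (leqP k #|H|) => [kH|/ltnW kH]; last by apply: leq_trans kH; rewrite -ltnS.
exact: (Hmin (Ordinal (kH : k < #|H|.+1))).
Qed.

Definition kneser_vertex (n m : nat) : finType := {X : {set 'I_n} | #|X| == m}.

(* KG^(k)(n, m): k-uniform, on the m-subsets of [n]. *)
Definition kneser (k n m : nat) : hypergraph :=
  @HyperGraph (kneser_vertex n m)
    [set h : {set kneser_vertex n m} | (#|h| == k) &&
      [forall X in h, forall Y in h, (X != Y) ==> [disjoint val X & val Y]]].

(* Main.v *)
Require Import Defs.
From mathcomp Require Import all_boot all_order all_algebra.
From mathcomp Require Import all_classical all_reals all_analysis.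
From mathcomp Require Import fintype finset zify.

(** Fix a proper colouring [f] of the Kneser hypergraph with [chi] colours, and
    let [N] be the number of its vertices.  The extremal graph consists of
    levels [0, ..., chi - 1], whose sizes grow like [m, m^2, ..., m^chi] with
    [m] of order [n^(1/chi)].  Level [i] is divided into one block of [m^(i+1)]
    vertices for every [X] with [f X = i].  Two vertices of different levels are
    adjacent, by an edge with a colour from the set [X] of the lower one; two
    vertices of the same level are adjacent when their sets [X] and [Y] meet,
    by an edge with a colour from [X :&: Y].  The vertices left over, up to the
    order [n], form a clique joined to everything else.

    An independent set with two or more vertices thus lies in one level and its
    vertices have pairwise disjoint sets, so [alpha + 1] of them would form a
    hyperedge on which [f] is constant ([blowup_independence]).

    A covering that uses at most [s] colours avoids all colours of some [X] of
    size [r - s].  Let [i = f X].  The only edges at the block of [X] with a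
    colour outside [X] come from levels below [i], which have at most [N * m^i]
    vertices.  In one graph of the covering each of these has at most [Delta]
    neighbours, so at most [K + Delta * N * m^i] of the [m^(i+1)] vertices of
    the block are covered by it ([card_copy_le]).  Therefore at least
    [m / (K + Delta * N)] graphs are needed ([blowup_covering_bound]). *)

Set Implicit Arguments.
Unset Strict Implicit.
Unset Printing Implicit Defensive.

Import Order.TTheory GRing.Theory Num.Theory.

(** * Counting the vertices of a copy of a bounded-degree graph *)

Lemma card_bigcup_le (I T : finType) (P : pred I) (A : I -> {set T}) k :
  (forall i, P i -> #|A i| <= k) -> #|\bigcup_(i | P i) A i| <= #|P| * k.
Proof.
move=> Ak; rewrite -sum_nat_const.
apply: (big_ind2 (fun (B : {set T}) l => #|B| <= l)) => //; first by rewrite cards0.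
by move=> B l B' l' Bl B'l'; apply: leq_trans (leq_card_setU _ _) (leq_add Bl B'l').
Qed.

Lemma exists_subset_card (T : finType) (A : {set T}) k :
  k <= #|A| -> exists2 B : {set T}, B \subset A & #|B| = k.
Proof.
rewrite -bin_gt0 -cards_draws => /card_gt0P[B]; rewrite inE => /andP[BA /eqP Bk].
by exists B.
Qed.

Lemma card_neighbours_le (H : sgraph) (h : H) :
  #|\bigcup_(e in edges H | h \in e) (e :\ h)| <= max_degree H.
Proof.
apply: leq_trans (leq_bigmax h); rewrite -[degree h]muln1 /degree cardsE.
by apply: card_bigcup_le => e /andP[/card_edge e2 he]; have := cardsD1 h e; lia.
Qed.

(** Apart from the images of at most [K] isolated vertices, every vertex of the
    copy in [D] is adjacent in the copy to a vertex of [L], and a vertex has at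
    most [Delta] neighbours there. *)
Lemma card_copy_le (Delta K : nat) (G H : sgraph) (S : presubgraph G)
    (D L : {set G}) :
  max_degree H <= Delta -> #|Defs.isolated H| <= K -> subgraph_iso H S ->
  (forall e v, e \in S.2 -> v \in e -> v \in D ->
     exists u, [/\ u \in e, u != v & u \in L]) ->
  #|S.1 :&: D| <= K + Delta * #|L|.
Proof.
move=> HD HK [f [finj fS1 fS2]] SDL.
pose N (h : H) := \bigcup_(e in edges H | h \in e) (e :\ h).
have sub : S.1 :&: D \subset
    f @: Defs.isolated H :|: f @: \bigcup_(h in f @^-1: L) N h.
  apply/subsetP => y; rewrite inE -fS1 => /andP[/imsetP[h _ ->] fhD].
  rewrite inE; case: (boolP (h \in Defs.isolated H)) => hiso.
    by rewrite (imset_f f hiso).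
  apply/orP; right; apply/imset_f.
  move: hiso; rewrite inE cards_eq0 => /set0Pn[e]; rewrite inE => /andP[eH he].
  have feS : f @: e \in S.2 by rewrite -fS2; apply/imsetP; exists e.
  have [_ [/imsetP[h' h'e ->] nhh' h'L]] := SDL _ _ feS (imset_f f he) fhD.
  apply/bigcupP; exists h'; first by rewrite inE.
  apply/bigcupP; exists e; first by rewrite eH.
  by rewrite !inE he andbT; apply: contraNneq nhh' => ->.
apply: leq_trans (subset_leq_card sub) _.
apply: leq_trans (_ : #|f @: Defs.isolated H| +
  #|f @: \bigcup_(h in f @^-1: L) N h| <= _).
  by rewrite cardsU leq_subr.
apply: leq_add; first exact: leq_trans (leq_imset_card _ _) HK.
apply: leq_trans (leq_imset_card _ _) _.
apply: leq_trans (_ : #|f @^-1: L| * Delta <= _); last first.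
  rewrite mulnC leq_mul2l -(card_imset _ finj); apply/orP; right.
  by apply/subset_leq_card/subsetP => _ /imsetP[h hL ->]; rewrite inE in hL.
by apply: card_bigcup_le => h _; apply: leq_trans (card_neighbours_le h) HD.
Qed.

(** * Graphs built from levels and colour lists *)

Section LevelledGraph.
Variables (r : nat) (V : finType) (lev : V -> nat) (lab : V -> {set 'I_r}).

(** For a pair [e] of vertices this treats both kinds of edges at once: it is
    the label of the lower vertex if the levels differ, and the intersection of
    the two labels otherwise. *)
Definition allowed (e : {set V}) : {set 'I_r} :=
  \bigcap_(v in e | [forall u in e, lev v <= lev u]) lab v.

Definition levelled_edges : {set {set V}} :=
  [set e : {set V} | (#|e| == 2) && (allowed e != set0)].

Fact card_levelled_edge (e : {set V}) : e \in levelled_edges -> #|e| = 2.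
Proof. by rewrite inE => /andP[/eqP]. Qed.

Definition levelled_graph : sgraph := SGraph card_levelled_edge.

Definition levelled_colouring (c0 : 'I_r) : edge_colouring r levelled_graph :=
  fun e => odflt c0 [pick c in allowed e].

(** An edge takes its colour from the labels of all its lowest endpoints; if the
    colour is not in the label of [v], then [v] is not a lowest one. *)
Lemma levelled_colour_lower c0 (e : {set V}) v :
  e \in levelled_edges -> v \in e -> levelled_colouring c0 e \notin lab v ->
  exists2 u, u \in e & lev u < lev v.
Proof.
rewrite inE => /andP[_ /set0Pn[c ce]] ve.
rewrite /levelled_colouring; case: pickP => [c' /bigcapP c'e|/(_ c)]; last first.
  by rewrite ce.
move=> /negP c'v; case: (boolP [forall u in e, lev v <= lev u]) => [vmin|].
  by case: c'v; apply: c'e; rewrite ve.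
by move=> /forall_inPn[u ue]; rewrite -ltnNge; exists u.
Qed.

Lemma levelled_nonadjacent (u v : V) :
  (forall w, lab w != set0) -> u != v -> [set u; v] \notin levelled_edges ->
  lev u = lev v /\ [disjoint lab u & lab v].
Proof.
move=> lab0 nuv; rewrite inE cards2 nuv /= negbK => /eqP al0.
have no c : c \notin allowed [set u; v] by rewrite al0 inE.
have noP c : ~ (forall w, w \in [set u; v] -> lev w <= lev u -> lev w <= lev v ->
     c \in lab w).
  move=> cw; apply: (negP (no c)); apply/bigcapP => w /andP[wuv /forall_inP wm].
  by apply: cw => //; apply: wm; rewrite !inE eqxx ?orbT.
case: (ltngtP (lev u) (lev v)) => luv.
- have /set0Pn[c cu] := lab0 u; case: (noP c) => w /set2P[] -> // h _; lia.
- have /set0Pn[c cv] := lab0 v; case: (noP c) => w /set2P[] -> // _ h; lia.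
- split=> //; apply/pred0P => c /=; apply/negP => /andP[cu cv].
  by case: (noP c) => w /set2P[] ->.
Qed.

(** A monochromatic graph whose colour is not in [X] reaches the vertices of
    label [X] and level [i] only from lower levels, so [card_copy_le] bounds the
    part covered by each member of [C]. *)
Lemma levelled_covering_bound c0 (Delta K i : nat) (X : {set 'I_r})
  F C : bounded_family Delta F -> few_isolated_family K F ->
  mono_covering (levelled_colouring c0) F C ->
  [disjoint X & levelled_colouring c0 @: (\bigcup_(S in C) S.2)] ->
  #|[set v | (lab v == X) && (lev v == i)]| <=
    #|C| * (K + Delta * #|[set u | lev u < i]|).
Proof.
move=> FD FK [Csub Ccov] XC.
set D := [set v | _ & _]; set L := [set u | _].
have sub : D \subset \bigcup_(S in C) (S.1 :&: D).
  apply/subsetP => v vD; have [S SC vS] := Ccov v.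
  by apply/bigcupP; exists S => //; rewrite inE vS.
apply: leq_trans (subset_leq_card sub) _.
apply: card_bigcup_le => S SC; have [[/subsetP SE SV] _ [H [FH HS]]] := Csub _ SC.
apply: (@card_copy_le _ _ levelled_graph H S D L (FD _ FH) (FK _ FH) HS).
move=> e v eS ve; rewrite inE => /andP[/eqP vX /eqP vi].
have ce : levelled_colouring c0 e \notin lab v.
  apply/negP; rewrite vX => cX; move/pred0P: XC => /(_ (levelled_colouring c0 e)).
  rewrite /= cX imset_f //; apply/bigcupP; by exists S.
have [u ue uv] := levelled_colour_lower (SE _ eS) ve ce.
exists u; split=> //; last by rewrite inE -vi.
by apply: contraTneq uv => ->; rewrite ltnn.
Qed.

End LevelledGraph.

(** * The blow-up of a coloured Kneser hypergraph *)

Section KneserBlowUp.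
Variables (r s chi : nat).
Variable f : {ffun kneser_vertex r (r - s) -> 'I_chi}.
Variables (m n : nat).
Let KV := kneser_vertex r (r - s).
Let N := #|KV|.

(** The right summand brings the order up to exactly [n].  These vertices form a
    clique on a level of their own, above all others, so that they affect
    neither the independence number nor the levels below a block. *)
Definition blowup_vertex : finType :=
  ({X : KV & 'I_(m ^ (f X).+1)} + 'I_(n - \sum_(X : KV) m ^ (f X).+1))%type.

Definition blowup_level (v : blowup_vertex) : nat :=
  if v is inl x then f (tag x) else chi.

Definition blowup_label (v : blowup_vertex) : {set 'I_r} :=
  if v is inl x then val (tag x) else setT.

Definition blowup : sgraph := levelled_graph blowup_level blowup_label.

Lemma card_blowup : N * m ^ chi <= n -> #|blowup| = n.
Proof.
move=> Nmn; rewrite card_sum card_tagged sumnE big_map big_enum /= card_ord.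
under eq_bigr => X _ do rewrite card_ord.
rewrite subnKC //; apply: leq_trans Nmn; rewrite -sum_nat_const.
apply: leq_sum => X _; case: m => [|m']; last by rewrite leq_pexp2l.
by rewrite exp0n.
Qed.

Lemma blowup_label_neq0 : s < r -> forall v, blowup_label v != set0.
Proof.
move=> sr [x|v] /=; last by rewrite -card_gt0 cardsT card_ord; lia.
by rewrite -card_gt0 (eqP (valP (tag x))); lia.
Qed.

(** The labels of [alpha + 1] pairwise nonadjacent vertices are a hyperedge of
    the Kneser hypergraph, all of whose vertices have the common level as
    colour. *)
Lemma blowup_independence alpha : 0 < alpha -> s < r ->
  [forall h in hyperedges (kneser alpha.+1 r (r - s)),
     ~~ [exists i, [forall v in h, f v == i]]] ->
  independence_number blowup <= alpha.
Proof.
move=> a0 sr f_proper; apply/bigmax_leqP => A /forall_inP Aind; rewrite leqNgt.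
apply/negP => /exists_subset_card[B BA Ba].
have lab0 := blowup_label_neq0 sr.
have nadj u v : u \in B -> v \in B -> u != v ->
    blowup_level u = blowup_level v /\ [disjoint blowup_label u & blowup_label v].
  move=> uB vB uv; apply: levelled_nonadjacent => //.
  apply/negP => /Aind /negP; apply; apply: fintype.subset_trans BA.
  by apply/subsetP => w /set2P[] ->.
have labelled u : u \in B ->
    exists X : KV, blowup_label u = val X /\ blowup_level u = f X.
  case: u => [x _|y yB]; first by exists (tag x).
  (* An extra vertex has the full label, which meets every other label. *)
  pose B' := B :\ inr y; have cardB' : #|B'| = alpha.
    by have := cardsD1 (inr y) B; rewrite yB Ba add1n => -[<-].
  have /card_gt0P[v] : 0 < #|B'| by rewrite cardB'.
  rewrite !inE => /andP[vy vB]; have [_] := nadj _ _ vB yB vy.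
  by rewrite -setI_eq0 setIT (negPf (lab0 v)).
(* The labels of the vertices of [B], as vertices of the Kneser hypergraph. *)
pose h := [set X : KV | [exists u in B,
  (blowup_label u == val X) && (blowup_level u == f X)]].
have hP X : X \in h ->
    exists u, [/\ u \in B, blowup_label u = val X & blowup_level u = f X].
  by rewrite inE => /exists_inP[u uB /andP[/eqP uX /eqP ulX]]; exists u.
have hcard : #|h| = alpha.+1.
  rewrite -(card_imset _ val_inj) -Ba -(@card_in_imset _ _ blowup_label).
    congr #|pred_of_set _|; apply/setP => Y; apply/imsetP/imsetP => -[].
      by move=> X /hP[u [uB uX _]] ->; exists u.
    move=> u uB ->; have [X [uX ulX]] := labelled _ uB; exists X => //.
    by rewrite inE; apply/exists_inP; exists u; rewrite // uX ulX !eqxx.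
  move=> u v uB vB luv; apply/eqP; apply: contraTT isT => uv.
  have [_] := nadj _ _ uB vB uv.
  by rewrite -luv -setI_eq0 setIid (negPf (lab0 u)).
have same X Y : X \in h -> Y \in h -> X != Y ->
    f X = f Y /\ [disjoint val X & val Y].
  move=> /hP[u [uB uX ulX]] /hP[v [vB vY vlY]] XY.
  have uv : u != v.
    by apply: contraNneq XY => uv; rewrite -val_eqE -uX -vY uv.
  have [luv] := nadj _ _ uB vB uv; rewrite uX vY => dXY.
  by split=> //; apply: val_inj; rewrite /= -ulX -vlY.
have hE : h \in hyperedges (kneser alpha.+1 r (r - s)).
  rewrite inE hcard eqxx /=; apply/forall_inP => X Xh.
  by apply/forall_inP => Y Yh; apply/implyP => /(same _ _ Xh Yh)[].
have /negP[] := forall_inP f_proper h hE.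
have /card_gt0P[X Xh] : 0 < #|h| by rewrite hcard.
apply/existsP; exists (f X); apply/forall_inP => Y Yh.
by have [->//|/(same _ _ Yh Xh)[->]] := eqVneq Y X.
Qed.

(** Some [X] avoids the colours of the covering.  Its block has [m^(i+1)]
    vertices and the levels below it at most [N * m^i], so the bound is what
    remains after cancelling [m^i]. *)
Lemma blowup_covering_bound c0 (Delta K : nat) (F : graph_family) C :
  bounded_family Delta F -> few_isolated_family K F ->
  mono_covering (levelled_colouring c0 : edge_colouring r blowup) F C ->
  colours_used (levelled_colouring c0 : edge_colouring r blowup) C <= s ->
  m <= #|C| * (K + Delta * N).
Proof.
move=> FD FK Ccov; rewrite /colours_used; set used := _ @: _ => used_s.
have [m0|m0] := posnP m; first by rewrite m0.
have [X XU Xrs] : exists2 X : {set 'I_r}, X \subset ~: used & #|X| = r - s.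
  apply: exists_subset_card.
  by rewrite leq_subLR -[X in X <= _]card_ord -(cardsC used) leq_add2r.
have Xm : #|X| == r - s by rewrite Xrs.
pose Y : KV := exist _ X Xm; pose i : nat := f Y.
have Xused : [disjoint X & used] by rewrite disjoints_subset.
have := levelled_covering_bound i FD FK Ccov Xused.
set D := [set v | _ & _]; set L := [set u | _] => DL.
pose block (Z : KV) (j : 'I_(m ^ (f Z).+1)) : blowup_vertex := inl (Tagged _ j).
have mD : m ^ i.+1 <= #|D|.
  have <- : #|[set: 'I_(m ^ (f Y).+1)]| = m ^ i.+1 by rewrite cardsT card_ord.
  rewrite -(@card_imset _ _ (@block Y)); last first.
    by move=> j j' [] /eqP; rewrite eq_Tagged => /eqP.
  apply/subset_leq_card/subsetP => _ /imsetP[j _ ->].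
  by rewrite inE /= !eqxx.
have mL : #|L| <= N * m ^ i.
  have LU : L \subset
      \bigcup_(Z : KV | f Z < i) (@block Z) @: [set: 'I_(m ^ (f Z).+1)].
    apply/subsetP => -[[Z j]|y]; rewrite inE /= => Zi; last first.
      by move: Zi; rewrite ltnNge (ltnW (ltn_ord (f Y))).
    by apply/bigcupP; exists Z => //; apply: (imset_f (@block Z)); rewrite inE.
  apply: leq_trans (subset_leq_card LU) _.
  apply: (@leq_trans (#|[pred Z | f Z < i]| * m ^ i)); last first.
    by rewrite leq_mul2r max_card orbT.
  apply: card_bigcup_le => Z Zi; apply: leq_trans (leq_imset_card _ _) _.
  by rewrite cardsT card_ord leq_pexp2l.
have mi : 0 < m ^ i by rewrite expn_gt0 m0.
rewrite -(leq_pmul2r mi) -expnS; apply: leq_trans mD (leq_trans DL _).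
rewrite -mulnA leq_mul2l mulnDl -mulnA; apply/orP; right.
by apply: leq_add; [rewrite leq_pmulr|rewrite leq_mul2l mL orbT].
Qed.

End KneserBlowUp.

(** * From the integer bound to the power of [n] *)

Lemma exists_root_floor N chi n : 0 < N -> 0 < chi ->
  exists m, N * m ^ chi <= n < N * m.+1 ^ chi.
Proof.
move=> N0 chi0; case: (@ex_maxnP (fun m => N * m ^ chi <= n) n).
- by exists 0; rewrite exp0n // muln0.
- move=> m; apply: leq_trans; apply: (leq_trans _ (leq_pmull _ N0)).
  by case: m => // m; rewrite -[X in X <= _]expn1 leq_pexp2l.
- move=> m Nm mmax; exists m; rewrite Nm ltnNge; apply/negP => /mmax.
  by rewrite ltnn.
Qed.

(** For positive [n], [k * M] is positive, and so [m <= k * M] gives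
    [m.+1 <= 2 * M * k]; this includes [m = 0], the case of small [n]. *)
Lemma root_bound N chi n m k M : 0 < N -> 0 < chi -> 0 < M ->
  (0 < n -> 0 < k) -> n < N * m.+1 ^ chi -> m <= k * M ->
  n <= (2 * N * M * k) ^ chi.
Proof.
move=> N0 chi0 M0 nk nN mk; case: (posnP n) => [->//|/nk k0].
apply: leq_trans (ltnW nN) _.
apply: (@leq_trans ((N * m.+1) ^ chi)).
  rewrite expnMn leq_mul2r; apply/orP; right.
  by case: (chi) chi0 => // p _; rewrite expnS leq_pmulr ?expn_gt0 ?N0.
by rewrite leq_exp2r //; nia.
Qed.

Theorem theorem1 (R : realType) (r s alpha Delta K : nat)
  (hr : (0 < r)%N) (hs : (0 < s)%N) (halpha : (0 < alpha)%N)
  (hDelta : (0 < Delta)%N) (hK : (0 < K)%N) (hrs : (s < r)%N) :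
  exists2 c : R, (0 < c)%R &
    forall F : graph_family,
      bounded_family Delta F -> few_isolated_family K F ->
      forall n : nat,
        ((c * powR (n%:R) ((chromatic_number (kneser alpha.+1 r (r - s)))%:R^-1))%R%:E
           <= max_cov_num R r s alpha n F)%E.
Proof.
set kg := kneser alpha.+1 r (r - s); set chi := chromatic_number kg.
have /existsP[f f_proper] : colourable kg chi.
  apply: (proj1 (chromatic_numberP _)) => h; rewrite inE => /andP[/eqP -> _].
  by rewrite ltnS.
set N := #|kneser_vertex r (r - s)|.
have N0 : 0 < N.
  have [|X _ /eqP Xrs] := @exists_subset_card _ [set: 'I_r] (r - s).
    by rewrite cardsT card_ord leq_subr.
  by apply/card_gt0P; exists (exist _ X Xrs).
have chi0 : 0 < chi.
  by case/card_gt0P: N0 => X _; apply: leq_ltn_trans (ltn_ord (f X)).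
set M := K + Delta * N; have M0 : 0 < M by rewrite /M; lia.
have q0 : (0 < (2 * N * M)%:R :> R)%R by rewrite ltr0n !muln_gt0 N0 M0.
exists (2 * N * M)%:R^-1%R => [|F FD FK n]; first by rewrite invr_gt0.
have [m /andP[Nm nN]] := exists_root_floor n N0 chi0.
apply: le_trans (ereal_sup_ubound _); last first.
  by exists (blowup f m n); split; [exact: card_blowup|exact: blowup_independence|].
apply: le_ereal_inf_tmp => _ [k kcov <-]; rewrite lee_fin.
have [C [Ccov Ck Cs]] := kcov (levelled_colouring (Ordinal hr)).
have mk : m <= k * M.
  apply: leq_trans (blowup_covering_bound FD FK Ccov Cs) _.
  by rewrite leq_mul2r Ck orbT.
have nk : 0 < n -> 0 < k.
  rewrite -(card_blowup f Nm) => /card_gt0P[v _]; apply: leq_trans Ck.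
  by have [S SC _] := Ccov.2 v; apply/card_gt0P; exists S.
have nroot := root_bound N0 chi0 M0 nk nN mk.
rewrite mulrC ler_pdivrMr // -natrM mulnC.
have -> : ((2 * N * M * k)%:R = powR ((2 * N * M * k) ^ chi)%:R chi%:R^-1 :> R)%R.
  rewrite natrX -powR_mulrn // -powRrM mulfV ?powRr1 //.
  by rewrite pnatr_eq0 -lt0n.
by apply: ge0_ler_powR; rewrite ?nnegrE ?invr_ge0 ?ler_nat.
Qed.
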